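(* Let $p$ be a prime and $q = 2^p$. Then $|\mathrm{Solv}(\mathrm{PSL}(2, q))| = 2q^2$.
   Context: For a finite group $G$ and $x \in G$, the solvabilizer of $x$ in $G$ is $\mathrm{Sol}_G(x) = \{y \in G : \langle x, y \rangle \text{ is solvable}\}$. $\mathrm{Solv}(G) = \{\mathrm{Sol}_G(x) : x \in G\}$ is the set of distinct solvabilizers of elements of $G$, and $|\mathrm{Solv}(G)|$ is its cardinality. *)

(* Defs.v *)
From HB Require Import structures.
From mathcomp Require Import all_boot all_order all_algebra all_fingroup all_solvable all_field.
Set Implicit Arguments.
Unset Strict Implicit.
Unset Printing Implicit Defensive.
Import GroupScope.

Definition solvabilizer (gT : finGroupType) (G : {set gT}) (x : gT) : {set gT} :=
  [set y in G | solvable <<[set x; y]>>].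

Definition Solv (gT : finGroupType) (G : {set gT}) : {set {set gT}} :=
  [set solvabilizer G x | x in G].

Definition SL2set (F : finFieldType) : {set {'GL_2[F]}} :=
  [set g : {'GL_2[F]} | (\det (GLval g) == 1)%R].

Lemma SL2_group_set (F : finFieldType) : group_set (SL2set F).
Proof.
apply/group_setP; split.
  by rewrite inE GL_1E det1.
move=> x y; rewrite !inE => /eqP dx /eqP dy.
by rewrite GL_MxE det_mulmx dx dy GRing.mulr1.
Qed.

Canonical SL2 (F : finFieldType) : {group {'GL_2[F]}} := Group (SL2_group_set F).

Definition PSL2 (F : finFieldType) := (SL2 F / 'Z(SL2 F))%g.

(* Main.v *)
Require Import Defs.
From mathcomp Require Import all_boot all_order all_algebra all_fingroup all_solvable all_field.
From mathcomp Require Import ring.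

(* In characteristic 2, SL_2(F) has trivial centre and every centralizer of a
   nontrivial element x is abelian, being SL_2(F) :&: F[x]. A nontrivial solvable
   subgroup has a nontrivial abelian normal subgroup, hence normalizes such a
   centralizer; in terms of traces, <x, y> is solvable iff tr [x, y] = 0 or two of
   tr x, tr y, tr xy vanish. For x = [a b; c d] with trace t, the solvabilizer of x
   then determines, and is determined by, the class of (b, c, t) where (b, c) is
   divided by t when t != 0 (the torus of x) and left alone when t = 0 (x itself).
   Every pair in F^2 occurs in both cases, which gives 2 q^2 solvabilizers. *)

Set Implicit Arguments.
Unset Strict Implicit.
Unset Printing Implicit Defensive.

Import GroupScope GRing.Theory.

(** * Solvability of groups with two generators *)

Section Groups.

Variable gT : finGroupType.
Implicit Types (G A : {group gT}) (x y : gT).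

(** Modulo [A] the two generators commute, so the derived subgroup lies in [A] and the second
    derived subgroup is trivial. *)
Lemma metabelian_gen2_sol A x y :
  abelian A -> x \in 'N(A) -> y \in 'N(A) -> [~ x, y] \in A ->
  solvable <<[set x; y]>>.
Proof.
move=> abA Nx Ny Axy; pose H := <<[set x; y]>>%G; change (solvable H).
have sN : [set x; y] \subset 'N(A) by rewrite subUset !sub1set Nx.
have abHA : abelian (H / A).
  rewrite quotient_gen // abelian_gen /quotient morphimU !morphim_set1 //.
  have cxy : coset A x * coset A y = coset A y * coset A x.
    apply/commgP; rewrite -morphR //; apply/eqP; exact: coset_id.
  by apply/centsP => u /set2P[]-> v /set2P[]->.
have sH'A : H^`(1) \subset A by apply: der1_min => //; rewrite gen_subG.
apply/derivedP; exists 2; apply/trivgP.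
by rewrite /= dergSn; apply: subset_trans (commgSS sH'A sH'A) _; rewrite (commG1P abA).
Qed.

Lemma gen2_mulr x y : <<[set x; x * y]>> = <<[set x; y]>>.
Proof.
apply/eqP; rewrite eqEsubset !gen_subG !subUset !sub1set.
have i u v : u \in <<[set u; v]>> by rewrite mem_gen ?set21.
have j u v : v \in <<[set u; v]>> by rewrite mem_gen ?set22.
rewrite !i /= groupM ?i ?j //=.
by rewrite -{1}(mulKg x y) groupM ?groupV ?i ?j.
Qed.

(** Both generators invert [x * y], hence normalize the cyclic group it generates, and their
    commutator is the square of [x * y]. *)
Lemma involutions_gen2_sol x y : x^-1 = x -> y^-1 = y -> solvable <<[set x; y]>>.
Proof.
move=> Vx Vy.
have Jx : (x * y) ^ x = (x * y)^-1 by rewrite /conjg invMg Vx Vy -!mulgA -{1}Vx mulKg.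
have Jy : (x * y) ^ y = (x * y)^-1.
  by rewrite /conjg invMg Vx Vy -!mulgA -{3}Vy mulgV mulg1.
apply: (@metabelian_gen2_sol <[x * y]>%G); rewrite ?cycle_abelian //.
- by rewrite inE -cycleJ Jx cycleV.
- by rewrite inE -cycleJ Jy cycleV.
by rewrite /commg /conjg Vx Vy mulgA groupM ?cycle_id.
Qed.

(** The last nontrivial term of the derived series serves as [A]. *)
Lemma sol_normal_abelian G :
  solvable G -> G :!=: 1 -> exists A : {group gT}, [/\ A <| G, A :!=: 1 & abelian A].
Proof.
move=> /derivedP exn ntG.
have [|m /eqP Gm minm] := @ex_minnP (fun n => G^`(n) == 1).
  by case: exn => n Gn; exists n; apply/eqP.
case: m Gm minm => [G0 _|m Gm minm]; first by case/eqP: ntG.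
exists G^`(m)%G; split; first exact: der_normal.
  by apply/eqP => Gm1; have := minm m; rewrite Gm1 eqxx ltnn => /(_ isT).
exact/commG1P.
Qed.

End Groups.

(** * Transport of solvabilizers along injective morphisms *)

Lemma injm_solvabilizer (aT rT : finGroupType) (D G : {group aT})
    (f : {morphism D >-> rT}) x :
  'injm f -> G \subset D -> x \in G ->
  solvabilizer (f @* G) (f x) = f @* solvabilizer G x.
Proof.
move=> injf sGD Gx; have Dx := subsetP sGD x Gx.
have solE y : y \in G ->
    solvable <<[set f x; f y]>> = solvable <<[set x; y]>>.
  move=> Gy; have Dy := subsetP sGD y Gy.
  have sD : [set x; y] \subset D by rewrite subUset !sub1set Dx.
  by rewrite -(injm_sol injf) ?gen_subG // morphim_gen // morphimU !morphim_set1.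
apply/setP=> z; apply/setIdP/morphimP => [[]|[y Dy]].
  by case/morphimP=> y Dy Gy -> ; rewrite solE // => sol; exists y; rewrite // inE Gy.
by case/setIdP=> Gy sol ->; rewrite mem_morphim ?solE.
Qed.

Lemma card_injm_Solv (aT rT : finGroupType) (D G : {group aT})
    (f : {morphism D >-> rT}) :
  'injm f -> G \subset D -> #|Solv (f @* G)| = #|Solv G|.
Proof.
move=> injf sGD.
have sSD (A : {set aT}) : A \in Solv G -> A \subset D.
  case/imsetP=> x _ ->; apply: subset_trans sGD.
  by apply/subsetP=> y /setIdP[].
rewrite -(card_in_imset (f := fun A : {set aT} => f @* A) (D := mem (Solv G))).
  apply: eq_card => A; apply/imsetP/imsetP => [[z /morphimP[x Dx Gx ->] ->]|[B]].
    by exists (solvabilizer G x); [apply: imset_f | apply: injm_solvabilizer].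
  case/imsetP=> x Gx -> ->; exists (f x); first by rewrite mem_morphim // (subsetP sGD).
  by rewrite injm_solvabilizer.
by move=> A B /sSD sA /sSD sB; apply: injm_morphim_inj.
Qed.

Local Open Scope ring_scope.

(** * Explicit two-by-two matrices *)

Section Matrix2.

Variable R : comNzRingType.

Definition mx2 (a b c d : R) : 'M[R]_2 :=
  \matrix_(i, j) if i == 0 then (if j == 0 then a else b)
                 else (if j == 0 then c else d).

Lemma mx2P (A : 'M[R]_2) : exists a b c d, A = mx2 a b c d.
Proof.
exists (A 0 0), (A 0 1), (A 1 0), (A 1 1); apply/matrixP => i j; rewrite !mxE.
by case: (unliftP 0 i) => [i' ->|->]; case: (unliftP 0 j) => [j' ->|->];
   rewrite /= ?(ord1 i') ?(ord1 j') //; congr (A _ _); apply: val_inj.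
Qed.

Lemma mx2_inj a b c d a' b' c' d' :
  mx2 a b c d = mx2 a' b' c' d' -> [/\ a = a', b = b', c = c' & d = d'].
Proof.
move/matrixP=> E.
by have := (E 0 0, E 0 1, E 1 0, E 1 1); rewrite !mxE /= => -[[[-> ->] ->] ->].
Qed.

Lemma mulmx2 a b c d a' b' c' d' :
  mx2 a b c d * mx2 a' b' c' d' =
  mx2 (a * a' + b * c') (a * b' + b * d') (c * a' + d * c') (c * b' + d * d').
Proof.
apply/matrixP => i j; rewrite !mxE !big_ord_recl big_ord0 !mxE /= addr0.
by case: ifP => _; case: ifP.
Qed.

Lemma addmx2 a b c d a' b' c' d' :
  mx2 a b c d + mx2 a' b' c' d' = mx2 (a + a') (b + b') (c + c') (d + d').
Proof. by apply/matrixP => i j; rewrite !mxE; case: ifP => _; case: ifP. Qed.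

Lemma scalemx2 k a b c d : k *: mx2 a b c d = mx2 (k * a) (k * b) (k * c) (k * d).
Proof. by apply/matrixP => i j; rewrite !mxE; case: ifP => _; case: ifP. Qed.

Lemma scalar_mx2 k : k%:M = mx2 k 0 0 k.
Proof.
apply/matrixP => i j; rewrite !mxE.
by case: (unliftP 0 i) => [i' ->|->]; case: (unliftP 0 j) => [j' ->|->];
   rewrite /= ?(ord1 i') ?(ord1 j').
Qed.

Lemma trmx2 a b c d : \tr (mx2 a b c d) = a + d.
Proof. by rewrite /mxtrace !big_ord_recl big_ord0 !mxE /= addr0. Qed.

Lemma detmx2 a b c d : \det (mx2 a b c d) = a * d - b * c.
Proof.
rewrite (expand_det_row _ 0) !big_ord_recl big_ord0 /cofactor !det_mx11 !mxE /=.
ring.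
Qed.

End Matrix2.

(** * Inverses and traces in SL_2 in characteristic 2 *)

Section SL2Char2.

(* [rho] stands for the inclusion of GL_2(F) in the matrices, with [G] = SL_2(F). *)
Variables (F : finFieldType) (gT : finGroupType) (G : {group gT}).
Variable rho : gT -> 'M[F]_2.
Hypothesis two0 : 1 + 1 = 0 :> F.
Hypothesis rho_inj : injective rho.
Hypothesis rhoM : forall g h, rho (g * h)%g = rho g * rho h.
Hypothesis rho1 : rho 1%g = 1.
Hypothesis SL2E : forall g, (g \in G) = (\det (rho g) == 1).
Hypothesis rho_onto : forall A, \det A = 1 -> exists g, rho g = A.

Implicit Types x y g h u : gT.

Definition tr g : F := \tr (rho g).

Lemma SL2P g : g \in G -> exists a b c d,
  [/\ rho g = mx2 a b c d, tr g = a + d & a * d = 1 + b * c].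
Proof.
have [a [b [c [d E]]]] := mx2P (rho g).
rewrite SL2E /tr E detmx2 trmx2 => /eqP dt.
by exists a, b, c, d; split=> //; rewrite -dt subrK.
Qed.

Lemma mx2_SL2 a b c d : a * d = 1 + b * c -> exists2 g, g \in G & rho g = mx2 a b c d.
Proof.
move=> dt; have d1 : \det (mx2 a b c d) = 1 by rewrite detmx2; ring: dt.
by have [g E] := rho_onto d1; exists g; rewrite ?SL2E ?E ?d1.
Qed.

(** This is Cayley-Hamilton for determinant 1, with [-1 = 1]. *)
Lemma SL2V g : g \in G -> rho g^-1%g = tr g *: 1 + rho g.
Proof.
move=> Gg; have [a [b [c [d [E Et dt]]]]] := SL2P Gg.
have gK : rho g * (tr g *: 1 + rho g) = 1.
  rewrite E Et -[1]/(1%:M) scalar_mx2 scalemx2 addmx2 mulmx2.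
  congr mx2; ring: two0 dt.
have gV : rho g^-1%g * rho g = 1 by rewrite -rhoM mulVg.
by rewrite -[LHS]mulr1 -[X in _ * X = _]gK mulrA gV mul1r.
Qed.

Lemma tr1 : tr 1%g = 0.
Proof. by rewrite /tr rho1 -[1]/(1%:M) scalar_mx2 trmx2. Qed.

Lemma tr_mulC g h : tr (g * h)%g = tr (h * g)%g.
Proof. by rewrite /tr !rhoM; apply: mxtrace_mulC. Qed.

Lemma trJ g h : tr (g ^ h)%g = tr g.
Proof. by rewrite /conjg tr_mulC -mulgA mulgV mulg1. Qed.

Lemma SL2V_mx2 g a b c d : g \in G ->
  rho g = mx2 a b c d -> rho g^-1%g = mx2 d b c a.
Proof.
move=> Gg E; rewrite SL2V // /tr E trmx2 -[1]/(1%:M) scalar_mx2.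
by rewrite scalemx2 addmx2; congr mx2; ring: two0.
Qed.

Lemma trV g : g \in G -> tr g^-1%g = tr g.
Proof.
move=> Gg; have [a [b [c [d [E Et _]]]]] := SL2P Gg.
by rewrite /tr (SL2V_mx2 Gg E) E !trmx2 addrC.
Qed.

Lemma tr_mulV g h : g \in G -> tr (g^-1 * h)%g = tr g * tr h + tr (g * h)%g.
Proof.
move=> Gg; rewrite /tr !rhoM SL2V // mulrDl -scalerAl mul1r.
by rewrite mxtraceD mxtraceZ.
Qed.

(* Fricke's trace identity; signs disappear in characteristic 2. *)
Lemma tr_comm x y : x \in G -> y \in G ->
  tr [~ x, y]%g = tr x ^+ 2 + tr y ^+ 2 + tr (x * y)%g ^+ 2
                  + tr x * tr y * tr (x * y)%g.
Proof.
move=> Gx Gy; have tr_sq g h : g \in G ->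
    tr (g * (g * h))%g = tr g * tr (g * h)%g + tr h.
  by move=> Gg; rewrite -{1}[g]invgK tr_mulV ?groupV // trV // mulKg.
have Exx : tr (x * (y * x))%g = tr x * tr (x * y)%g + tr y.
  by rewrite -tr_sq // [RHS]tr_mulC -mulgA.
have Exyxy : tr (y * (x * (y * x))) = tr (x * y)%g ^+ 2.
  have := tr_sq (y * x)%g 1%g (groupM Gy Gx).
  by rewrite mulg1 tr1 addr0 -expr2 -mulgA [in RHS]tr_mulC.
rewrite /commg tr_mulV // trJ tr_mulC /conjg -!mulgA tr_mulV // Exx Exyxy.
ring.
Qed.

(** * Centralizers in SL_2(F) *)

Lemma tr0_inv g : g \in G -> tr g = 0 -> g^-1%g = g.
Proof. by move=> Gg t0; apply: rho_inj; rewrite SL2V // t0 scale0r add0r. Qed.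

(** The trace of [k + l x] loses its term [2 k], and its determinant is the stated quadratic
    form. *)
Lemma comb_SL2 x y (k l : F) : x \in G -> y \in G ->
    rho y = k%:A + l *: rho x ->
  tr y = l * tr x /\ k ^+ 2 + k * l * tr x + l ^+ 2 = 1.
Proof.
move=> Gx Gy; have [a [b [c [d [Ex tx dx]]]]] := SL2P Gx.
have [e [f [g [h [-> -> dy]]]]] := SL2P Gy.
rewrite Ex tx -[1]/(1%:M) scalar_mx2 !scalemx2 addmx2.
case/mx2_inj=> Ee Ef Eg Eh; rewrite Ee Eh Ef Eg in dy *.
split; first by ring: two0.
transitivity ((k * 1 + l * a) * (k * 1 + l * d) - l * b * (l * c)).
  by ring: dx.
by rewrite dy; ring.
Qed.

(** A scalar matrix of determinant 1 is the identity in characteristic 2, so [x] is not scalar and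
    its centralizer is F[x]. The coefficient [l] is read from whichever of [b], [c], [a - d] is
    nonzero. *)
Lemma cent_comb x y : x \in G -> y \in G -> x != 1%g -> commute x y ->
  exists k l, rho y = k%:A + l *: rho x.
Proof.
move=> Gx Gy ntx cxy; have [a [b [c [d [Ex tx dx]]]]] := SL2P Gx.
have [e [f [g [h [Ey ty dy]]]]] := SL2P Gy.
have : rho (x * y)%g = rho (y * x)%g by rewrite cxy.
rewrite !rhoM {1 2}Ex {1 2}Ey !mulmx2 => /mx2_inj[E1 E2 E3 E4].
have {}E1 : g * b = f * c by apply: (addrI (a * e)); rewrite mulrC -E1; ring: E1.
have combI k l : e = k + l * a -> f = l * b -> g = l * c -> h = k + l * d ->
    exists k l, rho y = k%:A + l *: rho x.
  move=> Ee Ef Eg Eh; exists k, l; rewrite Ey Ex -[1]/(1%:M) scalar_mx2.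
  by rewrite !scalemx2 addmx2 Ee Ef Eg Eh !mulr0 !add0r !mulr1.
have [b0 | nzb] := eqVneq b 0; last first.
  apply: (combI (e - f / b * a) (f / b)); rewrite ?subrK ?divfK //.
    by apply: (mulIf nzb); rewrite E1 mulrAC divfK.
  apply: (mulIf nzb); transitivity (e * b + f * d - a * f); last by field.
  by rewrite -E2; ring.
have [c0 | nzc] := eqVneq c 0; last first.
  apply: (combI (e - g / c * a) (g / c)); rewrite ?subrK ?divfK //.
    by apply: (mulIf nzc); rewrite -E1 mulrAC divfK.
  apply: (mulIf nzc); transitivity (c * e + d * g - g * a); last by field.
  by rewrite E3; ring.
have nzad : a - d != 0.
  apply: contraNneq ntx => /eqP; rewrite subr_eq0 => /eqP ad.
  move: dx Ex; rewrite b0 c0 -ad mul0r addr0 => aa1 Ex.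
  have /eqP : (a + 1) * (a + 1) = 0.
    by transitivity ((1 + 1) * (1 + a)); [ring: aa1 | rewrite two0 mul0r].
  rewrite mulf_eq0 orbb => /eqP a1; have {}a1 : a = 1.
    by rewrite -[LHS]addr0 -two0 addrA a1 add0r.
  by apply/eqP/rho_inj; rewrite rho1 Ex a1 -[1 in RHS]/(1%:M) scalar_mx2.
rewrite b0 c0 in E2 E3.
have f0 : f = 0 by apply: (mulIf nzad); rewrite mul0r mulrBr mulrC; ring: E2.
have g0 : g = 0 by apply: (mulIf nzad); rewrite mul0r mulrBr mulrC; ring: E3.
apply: (combI (e - (e - h) / (a - d) * a) ((e - h) / (a - d))).
- by rewrite subrK.
- by rewrite b0 mulr0.
- by rewrite c0 mulr0.
by field.
Qed.

Lemma commute_trans x y z : x \in G -> y \in G -> z \in G -> x != 1%g ->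
  commute x y -> commute x z -> commute y z.
Proof.
move=> Gx Gy Gz ntx /(cent_comb Gx Gy ntx)[k [l Ey]] /(cent_comb Gx Gz ntx)[m [n Ez]].
apply: rho_inj; rewrite !rhoM Ey Ez !mulrDl !mulrDr.
rewrite -!(scalerAl, scalerAr) !mulr1 !mul1r !scalerA.
by rewrite [m * k]mulrC [m * l]mulrC [n * k]mulrC [n * l]mulrC addrACA.
Qed.

(** * The trace criterion for solvability *)

Lemma involutions_sol x y : x \in G -> y \in G -> tr x = 0 -> tr y = 0 ->
  solvable <<[set x; y]>>.
Proof.
by move=> Gx Gy /(tr0_inv Gx) Vx /(tr0_inv Gy) Vy; apply: involutions_gen2_sol.
Qed.

(** If the commutator [w] is nontrivial, its centralizer in [G] is abelian and contains [w]. Once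
    [w] commutes with its conjugates by [x] and [y], both generators normalize this centralizer. *)
Lemma sol_tr_comm x y : x \in G -> y \in G -> tr [~ x, y]%g = 0 ->
  solvable <<[set x; y]>>.
Proof.
move=> Gx Gy tw; set w := [~ x, y] in tw.
have [w1 | ntw] := eqVneq w 1%g.
  apply: (@metabelian_gen2_sol _ 1%G); rewrite ?abelian1 ?norm1 ?inE //.
  by rewrite -/w w1.
have Gw : w \in G by rewrite groupR.
(* [w - 1] is a multiple of [K], which conjugation by [x] or [y] only multiplies
   by units and whose square vanishes; so [w] commutes with its conjugates. *)
pose X := rho x; pose Y := rho y; pose K := X * Y - Y * X.
have opp2 : - (1 + 1) = 0 :> F by rewrite two0 oppr0.
have four0 : 1 + 1 + 1 + 1 = 0 :> F by rewrite two0 add0r two0.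
(* For [U = rho u], Cayley-Hamilton gives [U K + K U = tr u K], which in characteristic 2 is the
   claim. *)
have VK u : (u = x) \/ (u = y) -> rho u^-1%g * K = K * rho u.
  have [a [b [c [d [Ex _ dx]]]]] := SL2P Gx.
  have [e [f [g [h [Ey _ dy]]]]] := SL2P Gy.
  rewrite /K /X /Y; case=> ->; rewrite ?(SL2V_mx2 Gx Ex) ?(SL2V_mx2 Gy Ey) Ex Ey.
  - rewrite !mulmx2 -scaleN1r scalemx2 addmx2 !mulmx2; congr mx2;
      apply/eqP; rewrite -subr_eq0; apply/eqP; ring: dx opp2 two0 four0.
  - rewrite !mulmx2 -scaleN1r scalemx2 addmx2 !mulmx2; congr mx2;
      apply/eqP; rewrite -subr_eq0; apply/eqP; ring: dy opp2 two0 four0.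
have Wx : rho w - 1 = rho x^-1%g * rho y^-1%g * K.
  rewrite mulrBr -!rhoM; congr (_ - _).
    by rewrite /w /commg /conjg !mulgA.
  by rewrite mulgA mulgKV mulVg rho1.
have Vx := VK x (or_introl erefl); have Vy := VK y (or_intror erefl).
have EN : rho w - 1 = K * (X * Y) by rewrite Wx -mulrA Vy mulrA Vx mulrA.
have MV u : rho u * rho u^-1%g = 1 by rewrite -rhoM mulgV rho1.
have KV u : (u = x) \/ (u = y) -> rho u * K = K * rho u^-1%g.
  move=> xyu; rewrite -[LHS]mulr1 -(MV u) mulrA -[rho u * K * _]mulrA.
  by rewrite -VK // !mulrA MV mul1r.
(* Since [w] is its own inverse, [(w - 1)^2 = 0]. Moving the second [K] of [K X Y K X Y] to the left
   inverts [X] and [Y], so the same square is [K^2 w]. *)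
have K2 : K * K = 0.
  have NN : (rho w - 1) * (rho w - 1) = 0.
    rewrite mulrBr mulr1 mulrBl -rhoM -{1}(tr0_inv Gw tw) mulVg mul1r rho1.
    by rewrite opprB -mulr2n -scaler_nat (_ : 2%:R = 0) ?scale0r.
  have Kx := KV x (or_introl erefl); have Ky := KV y (or_intror erefl).
  have NNK : (rho w - 1) * (rho w - 1) = K * K * rho w.
    rewrite EN -!mulrA [Y * (K * _)]mulrA Ky -!mulrA [X * (K * _)]mulrA Kx -!mulrA.
    by rewrite /w /commg /conjg !rhoM.
  by rewrite -[LHS]mulr1 -(MV w) mulrA -NNK NN mul0r.
have cJ u : (u = x) \/ (u = y) -> commute w (w ^ u).
  move=> xyu; set V := rho u^-1%g; set U := rho u.
  pose N := rho w - 1; pose P := V * N * U.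
  have VKu := VK _ xyu.
  have N1 : N = _ := Wx; have N2 : N = _ := EN.
  (* In [N P] and [P N] the two factors [K] can be brought together, and [K^2 = 0]. *)
  have NP : N * P = 0.
    rewrite /P {1}N1 N2 -!mulrA.
    by rewrite [V * (K * _)]mulrA VKu -!mulrA [K * (K * _)]mulrA K2 mul0r !mulr0.
  have PN : P * N = 0.
    rewrite /P {1}N1 N2 -!mulrA [U * (K * _)]mulrA.
    by rewrite (KV _ xyu) -!mulrA [K * (K * _)]mulrA K2 mul0r !mulr0.
  have EP : rho (w ^ u)%g = P + 1.
    have VU : V * U = 1 by rewrite -rhoM mulVg rho1.
    by rewrite -VU -mulrDl -[V in _ + V]mulr1 -mulrDr subrK -!rhoM -mulgA.
  have Ew : rho w = N + 1 by rewrite subrK.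
  apply: rho_inj; rewrite [LHS]rhoM [RHS]rhoM EP Ew; clearbody P N.
  rewrite !mulrDl !mulrDr NP PN !mulr1 !mul1r.
  by rewrite !add0r addrCA.
have abA : abelian 'C_G[w].
  apply/centsP=> u /setIP[Gu /cent1P cu] v /setIP[Gv /cent1P cv].
  exact: (commute_trans Gw).
have nA u : (u = x) \/ (u = y) -> u \in 'N('C_G[w]).
  move=> xyu; have Gu : u \in G by case: xyu => ->.
  rewrite inE; apply/subsetP=> _ /imsetP[v /setIP[Gv /cent1P cv] ->].
  rewrite inE groupJ //=; apply/cent1P.
  apply: (commute_trans (x := w ^ u)); rewrite ?groupJ //.
  - by rewrite -(inj_eq (conjg_inj u)) conj1g in ntw *.
  - by rewrite /commute -!conjMg cv.
  - exact: commute_sym (cJ u xyu).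
apply: (@metabelian_gen2_sol _ 'C_G[w]%G) => //; try by apply: nA; auto.
by rewrite inE Gw; apply/cent1P.
Qed.

Lemma rhoJ_comb a b x (k l : F) :
  rho b = k%:A + l *: rho a -> rho (b ^ x)%g = k%:A + l *: rho (a ^ x)%g.
Proof.
have VU : rho x^-1%g * rho x = 1 by rewrite -rhoM mulVg rho1.
move=> Eb; rewrite /conjg !rhoM Eb mulrDl mulrDr -!(scalerAl, scalerAr).
by rewrite mul1r VU.
Qed.

(** From [x a^-1 = a x], the elements [a^-1 x] and [a x] have the same trace, so [tr_mulV] leaves
    [tr a * tr x = 0]. *)
Lemma inverted_tr0 a x : a \in G -> tr a != 0 ->
  (a ^ x = a^-1)%g -> tr x = 0.
Proof.
move=> Ga nta ax; apply: (mulfI nta); rewrite mulr0.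
by apply: (addIr (tr (a * x)%g)); rewrite -tr_mulV // add0r tr_mulC -ax -conjgC.
Qed.

(** Write the conjugate as [k + l a]. Equal traces force [l = 1], and then the determinant gives
    [k (k + tr a) = 0]; the two roots are [a] and its inverse. *)
Lemma conj_comm_cases a x : a \in G -> x \in G -> a != 1%g -> tr a != 0 ->
  commute a (a ^ x) -> (a ^ x = a \/ a ^ x = a^-1)%g.
Proof.
move=> Ga Gx nta ta /(cent_comb Ga (groupJ Ga Gx) nta)[k [l E]].
have [] := comb_SL2 Ga (groupJ Ga Gx) E; rewrite trJ => tl.
have {tl}l1 : l = 1 by apply: (mulIf ta); rewrite mul1r.
rewrite l1 scale1r in E *; rewrite mulr1 expr1n => /(canRL (addrK _)).
rewrite subrr expr2 -mulrDr => /eqP; rewrite mulf_eq0 => /orP[]/eqP k0.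
  by left; apply: rho_inj; rewrite E k0 scale0r add0r.
right; apply: rho_inj; rewrite E SL2V //; congr (_ *: _ + _).
apply: (addIr (tr a)); rewrite k0; transitivity ((1 + 1) * tr a); last by ring.
by rewrite two0 mul0r.
Qed.

(** The determinant condition reads [(k + l)^2 = 1]. Equivalently, conjugation by [x] multiplies the
    nilpotent matrix [a - 1] by the scalar [l]. *)
Lemma conj_comm_tr0 a x : a \in G -> x \in G -> a != 1%g -> tr a = 0 ->
  commute a (a ^ x) -> exists l, rho (a ^ x)%g = (1 + l)%:A + l *: rho a.
Proof.
move=> Ga Gx nta ta /(cent_comb Ga (groupJ Ga Gx) nta)[k [l E]].
have [_] := comb_SL2 Ga (groupJ Ga Gx) E; rewrite ta mulr0 addr0 => kl.
exists l; rewrite E; congr (_ *: _ + _); apply/eqP.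
rewrite -subr_eq0 -sqrf_eq0; apply/eqP.
transitivity (k ^+ 2 + l ^+ 2 - 1 + (1 + 1) * (1 + l - k - k * l)); first by ring.
by rewrite two0 kl subrr mul0r addr0.
Qed.

(** Take a nontrivial [a] in an abelian normal subgroup; it commutes with its conjugates. If
    [tr a = 0], then [x] and [y] scale [a - 1], so [x y (y x)^-1] centralizes [a] and has trace 0.
    Otherwise each of [x], [y], [x y] centralizes [a] or has trace 0: either two of them centralize
    [a], so that [x] and [y] commute, or two have trace 0. *)
Lemma solvable_gen2 x y : x \in G -> y \in G -> solvable <<[set x; y]>> ->
  [|| tr [~ x, y]%g == 0, (tr x == 0) && (tr y == 0),
      (tr x == 0) && (tr (x * y)%g == 0) |
      (tr y == 0) && (tr (x * y)%g == 0)].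
Proof.
move=> Gx Gy solH; pose H := <<[set x; y]>>%G.
have Hx : x \in H by rewrite mem_gen ?set21.
have Hy : y \in H by rewrite mem_gen ?set22.
have sHG : H \subset G by rewrite gen_subG subUset !sub1set Gx.
have [H1 | ntH] := eqVneq (H : {set _}) 1%g.
  by move: Hx; rewrite H1 inE => /eqP->; rewrite comm1g tr1 eqxx.
have [A [nAH ntA abA]] := sol_normal_abelian solH ntH.
have [a Aa nta] := trivgPn _ ntA.
have Ga : a \in G by apply: (subsetP sHG); apply: (subsetP (normal_sub nAH)).
have cJ u : u \in H -> commute a (a ^ u).
  move=> Hu; apply: (centsP abA) => //.
  by rewrite memJ_norm // (subsetP (normal_norm nAH)).
have [ta | ta] := eqVneq (tr a) 0.
  have [k Ex] := conj_comm_tr0 Ga Gx nta ta (cJ x Hx).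
  have [l Ey] := conj_comm_tr0 Ga Gy nta ta (cJ y Hy).
  have cxy : (a ^ (x * y) = a ^ (y * x))%g.
    apply: rho_inj; rewrite !conjgM (rhoJ_comb y Ex) // (rhoJ_comb x Ey) //.
    rewrite Ex Ey !scalerDr !scalerA !addrA -!scalerDl; congr (_ *: _ + _ *: _); last exact: mulrC.
    by ring: two0.
  have cac : commute a (x * y * (y * x)^-1)%g.
    by apply/commgP/conjg_fixP; rewrite conjgM cxy conjgK.
  have [k' [l' Ec]] := cent_comb Ga (groupM (groupM Gx Gy) (groupVr (groupM Gy Gx))) nta cac.
  have [] := comb_SL2 Ga (groupM (groupM Gx Gy) (groupVr (groupM Gy Gx))) Ec.
  rewrite ta mulr0 tr_mulC => tc _; apply/orP; left; apply/eqP; rewrite -[RHS]tc.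
  by rewrite /commg /conjg invMg !mulgA.
have caseJ u : u \in H -> (a ^ u = a)%g \/ tr u = 0.
  move=> Hu; have Gu := subsetP sHG u Hu.
  have [|au] := conj_comm_cases Ga Gu nta ta (cJ u Hu); first by left.
  by right; apply: inverted_tr0 au.
have commJ : (a ^ x = a)%g -> (a ^ y = a)%g -> tr [~ x, y]%g = 0.
  move=> ax ay; have /commgP/eqP-> : commute x y; last exact: tr1.
  by apply: (commute_trans Ga Gx Gy nta); apply/commgP/conjg_fixP.
have [ax | ->] := caseJ x Hx; have [ay | ->] := caseJ y Hy; rewrite ?eqxx ?orbT //.
- by rewrite commJ ?eqxx.
- have [axy | ->] := caseJ _ (groupM Hx Hy); last by rewrite eqxx !orbT.
  by rewrite commJ ?eqxx // -[in LHS]ax -conjgM.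
have [axy | ->] := caseJ _ (groupM Hx Hy); last by rewrite eqxx !orbT.
by rewrite commJ ?eqxx //; apply: (conjg_inj y); rewrite -conjgM axy.
Qed.

Lemma solvable_gen2P x y : x \in G -> y \in G ->
  solvable <<[set x; y]>> =
  [|| tr [~ x, y]%g == 0, (tr x == 0) && (tr y == 0),
      (tr x == 0) && (tr (x * y)%g == 0) |
      (tr y == 0) && (tr (x * y)%g == 0)].
Proof.
move=> Gx Gy; apply/idP/idP; first exact: solvable_gen2.
have Gxy : (x * y)%g \in G by rewrite groupM.
case/or4P=> [/eqP|/andP[/eqP tx /eqP ty]|/andP[/eqP tx /eqP txy]|/andP[/eqP ty /eqP txy]].
- exact: sol_tr_comm.
- exact: involutions_sol.
- by rewrite -gen2_mulr involutions_sol.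
rewrite setUC -gen2_mulr; apply: involutions_sol; rewrite ?groupM //.
by rewrite tr_mulC.
Qed.

(** A nontrivial central element would, by [commute_trans], make the upper and lower elementary
    matrices commute. *)
Lemma center_SL2 : 'Z(G) = 1%g.
Proof.
have [u Gu Eu] : exists2 u, u \in G & rho u = mx2 1 1 0 1.
  by apply: mx2_SL2; rewrite mulr0 addr0 mulr1.
have [v Gv Ev] : exists2 v, v \in G & rho v = mx2 1 0 1 1.
  by apply: mx2_SL2; rewrite mul0r addr0 mulr1.
apply/trivgP/subsetP=> z /centerP[Gz cz]; rewrite inE; apply: contraT => ntz.
have /(congr1 rho) := commute_trans Gz Gu Gv ntz (cz u Gu) (cz v Gv).
rewrite !rhoM Eu Ev !mulmx2 => /mx2_inj[/eqP].
by rewrite !mulr1 mulr0 addr0 two0 eq_sym oner_eq0.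
Qed.

(** * Solvability with an involution, and the prime subfield *)

Lemma tr_mx2M x y a b c d a' b' c' d' :
  rho x = mx2 a b c d -> rho y = mx2 a' b' c' d' ->
  tr (x * y)%g = a * a' + b * c' + (c * b' + d * d').
Proof. by move=> Ex Ey; rewrite /tr rhoM Ex Ey mulmx2 trmx2. Qed.

Definition pred01 (s : F) := (s == 0) || (s == 1).

Lemma pred01D1 s : pred01 (1 + s) = pred01 s.
Proof.
rewrite /pred01 orbC -(inj_eq (addrI 1) s 0) -(inj_eq (addrI 1) s 1).
by rewrite addr0 two0.
Qed.

(** With [tr x = 0] the commutator trace is [(tr (x y) - tr y)^2]. Its vanishing is the ratio 1; the
    remaining alternative [tr (x y) = 0] is the ratio 0. *)
Lemma solvable_involution x y : x \in G -> y \in G -> tr x = 0 -> tr y != 0 ->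
  solvable <<[set x; y]>> = pred01 (tr (x * y)%g / tr y).
Proof.
move=> Gx Gy tx nty; rewrite solvable_gen2P // tr_comm // tx eqxx (negPf nty) /= orbF.
have -> : 0 ^+ 2 + tr y ^+ 2 + tr (x * y)%g ^+ 2 + 0 * tr y * tr (x * y)%g
          = (tr (x * y)%g - tr y) ^+ 2 :> F.
  transitivity ((tr (x * y)%g - tr y) ^+ 2 + (1 + 1) * (tr (x * y)%g * tr y)); first by ring.
  by rewrite two0 mul0r addr0.
rewrite sqrf_eq0 subr_eq0 /pred01 mulf_eq0 invr_eq0 (negPf nty) orbF orbC.
by congr (_ || _); rewrite -(inj_eq (mulIf nty) (_ / _)) divfK ?mul1r.
Qed.

Hypothesis card_gt2 : exists w : F, ~~ pred01 w.

(** This recovers matrix entries from solvability tests with a parameter [s]. After a change of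
    variable one side is [pred01 s]; the values at 0 and 1 put the other slope in {0, 1}, and a
    point [w] outside the prime subfield excludes slope 0. *)
Lemma pred01_affine_inj (a b a' b' : F) :
  (forall s, pred01 (a + b * s) = pred01 (a' + b' * s)) -> b = b'.
Proof.
have [w nw] := card_gt2.
have main (m n m' n' : F) : n != 0 ->
    (forall s, pred01 (m + n * s) = pred01 (m' + n' * s)) -> n = n'.
  move=> nz E.
  have {}E s : pred01 s = pred01 (m' - n' * (m / n) + n' / n * s).
    have := E ((s - m) / n).
    have -> : m + n * ((s - m) / n) = s by field.
    by move->; congr pred01; ring.
  have := E 0; have := E 1; have := E w; rewrite (negPf nw) /pred01 !eqxx orbT.
  rewrite mulr0 addr0 mulr1; set A := m' - _; set k := n' / n => Ew E1 E0.
  have k01 : pred01 k.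
    case/esym/orP: E0 => /eqP A0; rewrite A0 ?add0r in E1; first by rewrite /pred01 -E1.
    by rewrite -pred01D1 /pred01 -E1.
  case/orP: k01 => /eqP k01.
    by rewrite k01 mul0r addr0 -E0 in Ew.
  by rewrite -[LHS]mul1r -k01 divfK.
have [b0 | nzb] := eqVneq b 0; last exact: main.
have [-> // | nzb'] := eqVneq b' 0.
by move=> E; apply/esym/(main a' _ a) => // s; rewrite E.
Qed.

(** * Labels, and their effect on solvabilizers *)

Lemma char2_sqrt (a : F) : exists r, r ^+ 2 = a.
Proof.
have sqr_inj : injective (fun r : F => r ^+ 2).
  move=> r s /= rs; apply/eqP; rewrite -subr_eq0 -sqrf_eq0; apply/eqP.
  transitivity (r ^+ 2 - s ^+ 2 + (1 + 1) * (s ^+ 2 - r * s)); first by ring.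
  by rewrite rs subrr two0 mul0r addr0.
by exists (invF sqr_inj a); apply: (f_invF sqr_inj).
Qed.

(* The division by [tr x] makes [label] constant on each torus minus the identity. *)
Definition label x : bool * (F * F) :=
  let s := if tr x == 0 then 1 else tr x in
  (tr x == 0, (rho x 0 1 / s, rho x 1 0 / s)).

Lemma labelE x a b c d : rho x = mx2 a b c d ->
  label x = let s := if a + d == 0 then 1 else a + d in (a + d == 0, (b / s, c / s)).
Proof. by move=> E; rewrite /label /tr E trmx2 !mxE. Qed.

Lemma label_onto l : exists x, x \in G /\ label x = l.
Proof.
case: l => -[] [b c].
  have [r Er] := char2_sqrt (1 + b * c).
  have [x Gx Ex] : exists2 x, x \in G & rho x = mx2 r b c r.
    by apply: mx2_SL2; rewrite -expr2.
  exists x; split=> //; rewrite (labelE Ex).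
  have -> : r + r = 0 by transitivity ((1 + 1) * r); [ring | rewrite two0 mul0r].
  by rewrite eqxx /= !divr1.
(* The matrix sought is [t] times [[s b; c s+1]]: its trace is [t] and its determinant is
   [t^2 (s^2 + s + b c)]. So [s] must make the bracket nonzero, and [t] is a square root of its
   inverse. *)
have [s nz] : exists s, s ^+ 2 + s + b * c != 0.
  have [bc0 | nz] := eqVneq (b * c) 0; last by exists 0; rewrite expr2 mul0r !add0r.
  have [w] := card_gt2; rewrite /pred01 negb_or => /andP[w0 w1].
  exists w; rewrite bc0 addr0 -{2}[w]mulr1 expr2 -mulrDr mulf_neq0 //.
  by apply: contraNneq w1 => E; rewrite -(inj_eq (addIr 1)) E two0.
have [t Et] := char2_sqrt (s ^+ 2 + s + b * c)^-1.
have ntt : t != 0 by rewrite -sqrf_eq0 Et invr_eq0.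
have [x Gx Ex] : exists2 x, x \in G & rho x = mx2 (s * t) (t * b) (t * c) (s * t + t).
  apply: mx2_SL2; rewrite -(mulVf nz) -Et.
  transitivity (t ^+ 2 * (s ^+ 2 + s + b * c) + t * b * (t * c) - (1 + 1) * (t * b * (t * c))).
    by ring.
  by rewrite two0 mul0r subr0.
exists x; split=> //; rewrite (labelE Ex).
have -> : s * t + (s * t + t) = t.
  by transitivity ((1 + 1) * (s * t) + t); [ring | rewrite two0 mul0r add0r].
by rewrite /= (negPf ntt) ![t * _]mulrC !mulfK.
Qed.

Lemma char2_addr_eq0 (p q : F) : p + q = 0 -> q = p.
Proof.
move=> pq; transitivity (p + q + p - (1 + 1) * p); first by ring.
by rewrite pq two0 mul0r subr0 add0r.
Qed.

(** Both diagonal entries equal a square root of [1 + b c], which is unique in characteristic 2. *)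
Lemma label_tr0_inj x y : x \in G -> y \in G -> tr x = 0 -> label x = label y -> x = y.
Proof.
move=> Gx Gy.
have [a [b [c [d [Ex tx dx]]]]] := SL2P Gx; have [e [f [g [h [Ey ty dy]]]]] := SL2P Gy.
rewrite tx (labelE Ex) (labelE Ey) => tx0; rewrite tx0 eqxx /= => -[/esym/eqP ty0].
rewrite ty0 eqxx !divr1 => Eb Ec.
rewrite (char2_addr_eq0 tx0) in Ex dx; rewrite (char2_addr_eq0 ty0) in Ey dy.
have ae : a = e.
  apply/esym/char2_addr_eq0/eqP; rewrite -sqrf_eq0; apply/eqP.
  transitivity (a * a - e * e + (1 + 1) * (a * e + e * e)); first by ring.
  by rewrite two0 dx dy Eb Ec subrr add0r mul0r.
by apply: rho_inj; rewrite Ex Ey ae Eb Ec.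
Qed.

(** By Fricke's identity and the determinant relation, replacing [x] by [k + l x] multiplies the
    trace of the commutator with [u] by [l^2]. When [tr u = 0], the trace of the product with [u] is
    multiplied by [l]. *)
Lemma solvabilizer_comb x y (k l : F) : x \in G -> y \in G -> tr x != 0 -> l != 0 ->
  rho y = k%:A + l *: rho x -> solvabilizer G y = solvabilizer G x.
Proof.
move=> Gx Gy ntx nzl E; apply/setP=> u; rewrite !inE; case Gu: (u \in G) => //=.
have [Ety dt] := comb_SL2 Gx Gy E.
have Ez : tr (y * u)%g = k * tr u + l * tr (x * u)%g.
  rewrite /tr !rhoM E mulrDl -!scalerAl mul1r mxtraceD !mxtraceZ //.
have nty : tr y != 0 by rewrite Ety mulf_neq0.
rewrite !solvable_gen2P // !tr_comm // (negPf ntx) (negPf nty) /= Ety Ez.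
congr (_ || _).
  rewrite -[RHS](inj_eq (mulfI (expf_neq0 2 nzl))) mulr0; congr (_ == 0).
  transitivity (l ^+ 2 * (tr x ^+ 2 + tr u ^+ 2 + tr (x * u)%g ^+ 2
      + tr x * tr u * tr (x * u)%g) + (1 - (k ^+ 2 + k * l * tr x + l ^+ 2)) * tr u ^+ 2
      + (1 + 1) * (tr u ^+ 2 * (k ^+ 2 + k * l * tr x) + k * l * tr u * tr (x * u)%g)).
    by ring.
  by rewrite dt subrr two0 !mul0r !addr0.
have [-> /= | //] := eqVneq (tr u) 0.
by rewrite mulr0 add0r mulf_eq0 (negPf nzl).
Qed.

Lemma label_solvabilizer x y : x \in G -> y \in G -> label x = label y ->
  solvabilizer G x = solvabilizer G y.
Proof.
move=> Gx Gy; have [tx0 Exy | ntx] := eqVneq (tr x) 0.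
  by rewrite (label_tr0_inj Gx Gy tx0 Exy).
have [a [b [c [d [Ex tx dx]]]]] := SL2P Gx; have [e [f [g [h [Ey ty dy]]]]] := SL2P Gy.
rewrite (labelE Ex) (labelE Ey) -tx -ty (negPf ntx) /= => -[/esym/negbT nty].
rewrite (negPf nty) => Ef Eg; apply/esym.
(* Equal labels make the off-diagonal entries of [y] equal to [l] times those of [x]; the scalar
   [e - l * a] then corrects the diagonal. *)
pose l := tr y / tr x.
apply: (@solvabilizer_comb _ _ (e - l * a) l) => //.
  by rewrite mulf_neq0 ?invr_eq0.
rewrite Ey Ex -[1]/(1%:M) scalar_mx2 !scalemx2 addmx2 !mulr0 !add0r !mulr1 subrK.
congr mx2.
- by rewrite /l mulrAC -mulrA Ef mulrC divfK.
- by rewrite /l mulrAC -mulrA Eg mulrC divfK.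
transitivity (tr y - e); first by rewrite ty addrC addKr.
have -> : tr y = l * tr x by rewrite /l divfK.
rewrite tx; transitivity (e - l * a + l * d + (1 + 1) * (l * a - e)); first by ring.
by rewrite two0 mul0r addr0.
Qed.

(** * Recovering the label from the solvabilizer *)

Lemma solvable_upper_unipotent s : exists u, [/\ u \in G, tr u = 0 &
  forall x, x \in G -> tr x != 0 ->
    solvable <<[set x; u]>> = pred01 (1 + rho x 1 0 / tr x * s)].
Proof.
have [u Gu Eu] : exists2 u, u \in G & rho u = mx2 1 s 0 1.
  by apply: mx2_SL2; rewrite mulr0 addr0 mulr1.
have tu : tr u = 0 by rewrite /tr Eu trmx2.
exists u; split=> // x Gx ntx; have [a [b [c [d [Ex tx _]]]]] := SL2P Gx.
(* Here [tr (x u) = tr x + c s], so varying [s] exposes the label coordinate [c / tr x]. *)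
rewrite setUC solvable_involution // tr_mulC (tr_mx2M Ex Eu).
congr pred01; transitivity (tr x / tr x + c / tr x * s); last by rewrite divff // Ex mxE.
by rewrite [X in _ = X / _ + _]tx; ring.
Qed.

Lemma solvable_lower_unipotent s : exists u, [/\ u \in G, tr u = 0 &
  forall x, x \in G -> tr x != 0 ->
    solvable <<[set x; u]>> = pred01 (1 + rho x 0 1 / tr x * s)].
Proof.
have [u Gu Eu] : exists2 u, u \in G & rho u = mx2 1 0 s 1.
  by apply: mx2_SL2; rewrite mul0r addr0 mulr1.
have tu : tr u = 0 by rewrite /tr Eu trmx2.
exists u; split=> // x Gx ntx; have [a [b [c [d [Ex tx _]]]]] := SL2P Gx.
rewrite setUC solvable_involution // tr_mulC (tr_mx2M Ex Eu).
congr pred01; transitivity (tr x / tr x + b / tr x * s); last by rewrite divff // Ex mxE.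
by rewrite [X in _ = X / _ + _]tx; ring.
Qed.

(** Take [u] with label [(false, (p, q))]. As [x] has equal diagonal entries, only the trace of [u]
    meets them, and it cancels in the ratio; varying [q] or [p] exposes an off-diagonal entry of
    [x]. *)
Lemma solvable_nontr0 (p q : F) : exists u, [/\ u \in G, tr u != 0 &
  forall x, x \in G -> tr x = 0 ->
    solvable <<[set x; u]>> = pred01 (rho x 0 0 + (rho x 0 1 * q + rho x 1 0 * p))].
Proof.
have [u [Gu lu]] := label_onto (false, (p, q)).
have [e [f [g [h [Eu tu _]]]]] := SL2P Gu.
move: lu; rewrite (labelE Eu) -tu /=; have [//|ntu] := eqVneq (tr u) 0 => -[Ep Eq].
have [Ef Eg] : f = p * tr u /\ g = q * tr u by rewrite -Ep -Eq !divfK.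
exists u; split=> // x Gx tx0; have [a [b [c [d [Ex tx _]]]]] := SL2P Gx.
have ad : d = a by apply: char2_addr_eq0; rewrite -tx.
rewrite solvable_involution // (tr_mx2M Ex Eu) Ex !mxE /= Ef Eg ad; congr pred01.
transitivity (a * (e + h) / tr u + (b * q + c * p) * (tr u / tr u)); first by ring.
by rewrite -tu divff // mulfK // mulr1.
Qed.

(** Equality would put every trace-zero element in the solvabilizer of [x]. The unipotent tests then
    force [x] to be diagonal, and one more trace-zero element gives a contradiction. *)
Lemma solvabilizer_tr0_neq x y : x \in G -> y \in G -> tr x != 0 -> tr y = 0 ->
  solvabilizer G x <> solvabilizer G y.
Proof.
move=> Gx Gy ntx ty /setP E.
have sol u : u \in G -> tr u = 0 -> solvable <<[set x; u]>>.
  by move=> Gu tu; have := E u; rewrite !inE Gu /= => ->; apply: involutions_sol.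
have c0 : rho x 1 0 / tr x = 0.
  apply: (@pred01_affine_inj 1 _ 1) => s.
  have [u [Gu tu /(_ x Gx ntx) <-]] := solvable_upper_unipotent s.
  by rewrite sol // mul0r addr0 /pred01 eqxx orbT.
have b0 : rho x 0 1 / tr x = 0.
  apply: (@pred01_affine_inj 1 _ 1) => s.
  have [u [Gu tu /(_ x Gx ntx) <-]] := solvable_lower_unipotent s.
  by rewrite sol // mul0r addr0 /pred01 eqxx orbT.
have [a [b [c [d [Ex tx _]]]]] := SL2P Gx.
have [w nw] := card_gt2; case/negP: nw.
(* For diagonal [x], the constant diagonal [w] gives [tr (x u) / tr x = w], outside the prime
   subfield. *)
have [u Gu Eu] : exists2 u, u \in G & rho u = mx2 w (w * w - 1) 1 w.
  by apply: mx2_SL2; ring.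
have tu : tr u = 0 by rewrite /tr Eu trmx2 -[w]mulr1 -mulrDr two0 mulr0.
have := sol u Gu tu; rewrite setUC solvable_involution // tr_mulC (tr_mx2M Ex Eu).
move: b0 c0; rewrite Ex !mxE /= => /eqP; rewrite mulf_eq0 invr_eq0 (negPf ntx) orbF => /eqP->.
move=> /eqP; rewrite mulf_eq0 invr_eq0 (negPf ntx) orbF => /eqP->.
by rewrite !mul0r addr0 add0r -mulrDl -tx mulrAC divff // mul1r.
Qed.

Lemma solvabilizer_label x y : x \in G -> y \in G ->
  solvabilizer G x = solvabilizer G y -> label x = label y.
Proof.
move=> Gx Gy Exy.
have solE u : u \in G -> solvable <<[set x; u]>> = solvable <<[set y; u]>>.
  by move=> Gu; have /setP/(_ u) := Exy; rewrite !inE Gu.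
have [tx0 | ntx] := eqVneq (tr x) 0; have [ty0 | nty] := eqVneq (tr y) 0.
- rewrite /label tx0 ty0 eqxx !divr1; congr (_, (_, _));
    apply: (@pred01_affine_inj (rho x 0 0) _ (rho y 0 0)) => s.
  + have [u [Gu _ solu]] := solvable_nontr0 0 s.
    by have := solE u Gu; rewrite !solu // !mulr0 !addr0.
  have [u [Gu _ solu]] := solvable_nontr0 s 0.
  by have := solE u Gu; rewrite !solu // !mulr0 !add0r.
- by case: (solvabilizer_tr0_neq Gy Gx nty tx0).
- by case: (solvabilizer_tr0_neq Gx Gy ntx ty0).
rewrite /label (negPf ntx) (negPf nty); congr (_, (_, _));
  apply: (@pred01_affine_inj 1 _ 1) => s.
  by have [u [Gu _ solu]] := solvable_lower_unipotent s; rewrite -!solu ?solE.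
by have [u [Gu _ solu]] := solvable_upper_unipotent s; rewrite -!solu ?solE.
Qed.

(** A section [s] of [label] enumerates the solvabilizers without repetition, one for each element
    of bool x F x F. *)
Lemma card_SL2_Solv : #|Solv G| = (2 * #|F| ^ 2)%N.
Proof.
have [s sP] := fin_all_exists label_onto.
have -> : Solv G = [set solvabilizer G (s l) | l in [set: bool * (F * F)]].
  apply/setP=> A; apply/imsetP/imsetP=> [[x Gx ->] | [l _ ->]].
    have [Gs Es] := sP (label x).
    by exists (label x); rewrite ?inE //; apply: label_solvabilizer.
  by exists (s l) => //; case: (sP l).
rewrite card_imset; first by rewrite cardsT !card_prod card_bool mulnn.
move=> l m; have [Gl El] := sP l; have [Gm Em] := sP m.
by move/(solvabilizer_label Gl Gm); rewrite El Em.
Qed.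

End SL2Char2.

(** * Passage from SL_2(F) to PSL_2(F) *)

Local Open Scope nat_scope.

Theorem theorem3p7 (p : nat) (F : finFieldType) :
  prime p -> #|F| = 2 ^ p -> #|Solv (PSL2 F)| = 2 * (2 ^ p) ^ 2.
Proof.
move=> p_pr cardF.
have two0 : (1 + 1 = 0 :> F)%R.
  by have := pcharf0 (card_finPcharP cardF isT).
(* As [p] is at least 2, the field has at least four elements. *)
have card_gt2 : exists w : F, ~~ pred01 w.
  apply/existsP; apply: contraT => /existsPn all01.
  have : #|F| <= #|[:: 0; 1 : F]%R|.
    by apply/subset_leq_card/subsetP => w _; have := all01 w; rewrite negbK !inE.
  rewrite leqNgt (leq_ltn_trans (card_size _)) //= cardF.
  by apply: leq_trans (leq_pexp2l (isT : 0 < 2) (prime_gt1 p_pr)).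
have rho1 : GLval (1%g : {'GL_2[F]}) = 1%R by rewrite GL_1E.
have SL2E (g : {'GL_2[F]}) : (g \in SL2 F) = (\det (GLval g) == 1)%R by rewrite inE.
have rho_onto (A : 'M[F]_2) : (\det A = 1)%R -> exists g : {'GL_2[F]}, GLval g = A.
  move=> d1; have uA : A \in unitmx by rewrite unitmxE d1 unitr1.
  by exists (FinRing.Unit (uA : (A : 'M_(2.-1.+1)) \is a GRing.unit)).
have rho_inj : injective (@GLval 2 F) by exact: val_inj.
have rhoM (g h : {'GL_2[F]}) : GLval (g * h)%g = (GLval g * GLval h)%R by [].
rewrite -cardF -(card_SL2_Solv two0 rho_inj rhoM rho1 SL2E rho_onto card_gt2).
(* PSL_2(F) is the image of SL_2(F) under the coset map, which is injective because the centre is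
   trivial. *)
apply: card_injm_Solv; last exact: normal_norm (center_normal _).
by rewrite ker_coset /= (center_SL2 two0 rho_inj rhoM rho1 SL2E rho_onto).
Qed.
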